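(* Let $J\ge 2$ and, for every dimension $d$, let $F_1,\ldots,F_J$ be probability distributions on $\mathbb{R}^d$ (the $J$ competing classes) satisfying assumptions (A1)–(A3) stated in the context. For each $j$, let $\mathbf{X}_{j1},\ldots,\mathbf{X}_{jn_j}$ be a training sample from $F_j$ with $n_j\ge 2$ fixed (not depending on $d$), all training observations being mutually independent, and let the test observation $\mathbf{Z}$ be independent of the training data. Then: (a) If $\nu_{ji}^2>|\sigma_j^2-\sigma_i^2|$ for all $j\neq i$, the misclassification probability of the $k$-nearest neighbor classifier with $k<\min\{n_1,\ldots,n_J\}$ converges to $0$ as $d\to\infty$. However, if $\nu_{ji}^2<|\sigma_j^2-\sigma_i^2|$ for some $j\neq i$, then all observations from at least one class are misclassified by this classifier with probability tending to $1$ as $d\to\infty$. (b) If $\nu_{ji}^2>0$ for all $j\neq i$, the misclassification probability of the CH classifier converges to $0$ as $d\to\infty$. (c) If for all $j\neq i$ either $\nu_{ji}^2>0$ or $\sigma_j^2\neq\sigma_i^2$, the misclassification probability of the MCH classifier converges to $0$ as $d\to\infty$.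
   Context: ''Measurement variables'' are the coordinates of a random vector. Assumptions: (A1) In each of the $J$ classes, the coordinates have fourth moments bounded uniformly (over coordinates and over $d$). (A2) If $\mathbf{X}=(X_1,\ldots,X_d)^\top\sim F_j$ and $\mathbf{Y}=(Y_1,\ldots,Y_d)^\top\sim F_i$ ($1\le j,i\le J$) are independent and $\mathbf{U}=\mathbf{X}-\mathbf{Y}$, then $\sum_{r\neq s}|\mathrm{Corr}(U_r^2,U_s^2)|=o(d^2)$ as $d\to\infty$. (A3) Let $\boldsymbol{\mu}_j$ and $\boldsymbol{\Sigma}_j$ be the mean vector and dispersion matrix of $F_j$. For each $j$ there is a constant $\sigma_j^2$ with $\mathrm{trace}(\boldsymbol{\Sigma}_j)/d\to\sigma_j^2$, and for each $i\neq j$ there is a constant $\nu_{ji}^2$ with $\|\boldsymbol{\mu}_j-\boldsymbol{\mu}_i\|^2/d\to\nu_{ji}^2$, as $d\to\infty$. The $k$-nearest neighbor classifier assigns $\mathbf{Z}$ to the class having the most representatives among the $k$ training points closest to $\mathbf{Z}$ in Euclidean norm $\|\cdot\|$. The CH classifier computes $\rho_j(\mathbf{Z},\mathbf{X}_{ji})=\|\mathbf{Z}-\mathbf{X}_{ji}\|^2-\frac12\binom{n_j}{2}^{-1}\sum_{1\le s<t\le n_j}\|\mathbf{X}_{js}-\mathbf{X}_{jt}\|^2$ and assigns $\mathbf{Z}$ to the class $j_0$ with $\min_{i}\rho_{j_0}(\mathbf{Z},\mathbf{X}_{j_0i})<\min_i\rho_j(\mathbf{Z},\mathbf{X}_{ji})$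 for all $j\ne j_0$. The MCH classifier is the same with $\rho^*_j(\mathbf{Z},\mathbf{X}_{ji})=\|\mathbf{Z}-\mathbf{X}_{ji}\|-\frac12\binom{n_j}{2}^{-1}\sum_{1\le s<t\le n_j}\|\mathbf{X}_{js}-\mathbf{X}_{jt}\|$ in place of $\rho_j$. The misclassification probability converging to $0$ means that for each $j$, the probability that a test observation $\mathbf{Z}\sim F_j$ is not assigned to class $j$ tends to $0$. *)

(* Defs.v *)
From HB Require Import structures.
From mathcomp Require Import all_boot all_order all_algebra.
From mathcomp Require Import all_classical all_reals all_analysis.
Set Implicit Arguments. Unset Strict Implicit. Unset Printing Implicit Defensive.
Import Order.TTheory GRing.Theory Num.Theory numFieldNormedType.Exports.
Local Open Scope classical_set_scope.
Local Open Scope ring_scope.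

Section Defs.
Variable R : realType.

(* Borel (= product) sigma-algebra on R^d = 'I_d -> R, generated by the
   coordinate maps. *)
Definition Rd_meas (d : nat) : set (set ('I_d -> R)) :=
  <<s \bigcup_(r in [set: 'I_d]) [set (fun x : 'I_d -> R => x r) @^-1` B | B in measurable] >>.

Definition enorm (d : nat) (v : 'I_d -> R) : R := Num.sqrt (\sum_(r < d) v r ^+ 2).

Definition fmin (n : nat) : ('I_n -> R) -> R :=
  match n return ('I_n -> R) -> R with
  | 0 => fun _ => 0
  | m.+1 => fun f => \big[Num.min/f ord0]_(i < m.+1) f i
  end.

Section Proba.
Context {dsp : measure_display} {T : measurableType dsp}.
Variable P : probability T R.

Definition Ex (f : T -> R) : R := Rintegral P setT f.
Definition Cov (f g : T -> R) : R := Ex (fun w => f w * g w) - Ex f * Ex g.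
Definition Var (f : T -> R) : R := Cov f f.
(* Corr = Cov / sqrt(Var Var); equals 0 (since x / 0 = 0) when a variance vanishes *)
Definition Corr (f g : T -> R) : R := Cov f g / Num.sqrt (Var f * Var g).

Definition mutually_indep (I : finType) (d : nat) (Y : I -> T -> ('I_d -> R)) :=
  forall A : I -> set ('I_d -> R), (forall k, Rd_meas (A k)) ->
    P (\bigcap_(k in [set: I]) (Y k @^-1` A k)) = (\prod_(k : I) P (Y k @^-1` A k))%E.

Definition same_law (d : nat) (X Y : T -> ('I_d -> R)) :=
  forall A, Rd_meas A -> P (X @^-1` A) = P (Y @^-1` A).
End Proba.

Section Classifiers.
Variables (J : nat) (n : 'I_J -> nat) (d : nat).
Definition tidx := {j : 'I_J & 'I_(n j)}.
Variables (z : 'I_d -> R) (x : forall j : 'I_J, 'I_(n j) -> ('I_d -> R)).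

Definition tdist (s : tidx) : R := enorm (fun r => z r - @x (tag s) (tagged s) r).

Definition knn_set (k : nat) (N : {set tidx}) : Prop :=
  #|N| = k /\ forall s t, s \in N -> t \notin N -> tdist s <= tdist t.

Definition votes (N : {set tidx}) (j : 'I_J) : nat := #|[set s in N | tag s == j]|.

(* z is assigned to class j by the k-NN rule, whatever the tie-breaking *)
Definition knn_surely (k : nat) (j : 'I_J) : Prop :=
  forall N, knn_set k N -> forall j', j' != j -> (votes N j' < votes N j)%N.

(* z may be assigned to class j by the k-NN rule under some tie-breaking *)
Definition knn_possibly (k : nat) (j : 'I_J) : Prop :=
  exists N, knn_set k N /\ forall j', (votes N j' <= votes N j)%N.

Definition avg_pair (j : 'I_J) (g : R -> R) : R :=
  ('C(n j, 2)%:R)^-1 *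
  \sum_(s < n j) \sum_(t < n j | (s < t)%N) g (enorm (fun r => @x j s r - @x j t r)).

Definition rho (j : 'I_J) (i : 'I_(n j)) : R :=
  enorm (fun r => z r - @x j i r) ^+ 2 - 2^-1 * avg_pair j (fun u => u ^+ 2).

Definition rho_star (j : 'I_J) (i : 'I_(n j)) : R :=
  enorm (fun r => z r - @x j i r) - 2^-1 * avg_pair j id.

Definition CH_assign (j0 : 'I_J) : Prop :=
  forall j, j != j0 -> fmin (@rho j0) < fmin (@rho j).

Definition MCH_assign (j0 : 'I_J) : Prop :=
  forall j, j != j0 -> fmin (@rho_star j0) < fmin (@rho_star j).
End Classifiers.
End Defs.

(* Main.v *)
(* Convergence in probability is treated as convergence along the filter [whp]
   on pairs (dimension, outcome), whose sets hold with probability tending to 1.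
   By (A1) and (A2) the variance of |U|^2 for a difference U of independent
   observations of classes j and i is o(d^2), and by (A3) its mean is
   d * (sigma_j^2 + sigma_i^2 + nu_ji^2) + o(d); so Chebyshev's inequality gives
   the limit of all the scaled squared distances |U|^2 / d in probability.  There
   are finitely many of them, and each classifier compares continuous functions
   of them whose limits are strictly ordered: for k-NN, 2 sigma_j^2 against
   sigma_j^2 + sigma_i^2 + nu_ji^2; for CH, sigma_j^2 against sigma_j^2 + nu_ji^2;
   for MCH the strict inequality is the one between the arithmetic and quadratic
   means of sqrt(2 sigma_j^2) and sqrt(2 sigma_i^2). *)

Require Import Defs.
From HB Require Import structures.
From mathcomp Require Import all_boot all_order all_algebra.
From mathcomp Require Import all_classical all_reals all_analysis.
From mathcomp Require Import ring lra measurable_realfun.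
Import Order.TTheory GRing.Theory Num.Theory numFieldNormedType.Exports.
Local Open Scope classical_set_scope.
Local Open Scope ring_scope.

(** * Laws of pairs of independent variables *)

Section Laws.
Context {dsp : measure_display} {T : measurableType dsp} {R : realType}.
Variable P : probability T R.

(** For nonnegative [h] both sides are integrals of [h] against the image measures of [f] and [g],
    which agree on measurable sets. A signed [h] is split into its positive and negative parts. *)
Lemma eq_law_integral {d1} {T1 : measurableType d1} {f g : T -> T1} {h : T1 -> \bar R} :
  measurable_fun setT f -> measurable_fun setT g -> measurable_fun [set: T1] h ->
  (forall B, measurable B -> P (f @^-1` B) = P (g @^-1` B)) ->
  (\int[P]_w h (f w) = \int[P]_w h (g w))%E.
Proof.
move=> mf mg mh fg.
have ge0 (k : T1 -> \bar R) : measurable_fun [set: T1] k -> (forall x, 0 <= k x)%E ->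
    (\int[P]_w k (f w) = \int[P]_w k (g w))%E.
  move=> mk k0.
  have := @ge0_integral_pushforward _ _ _ _ _ f mf P setT k measurableT mk (fun y _ => k0 y).
  rewrite preimage_setT => <-.
  have := @ge0_integral_pushforward _ _ _ _ _ g mg P setT k measurableT mk (fun y _ => k0 y).
  rewrite preimage_setT => <-.
  by apply: eq_measure_integral => A mA _; exact: fg.
rewrite integralE [RHS]integralE; congr (_ - _)%E.
  under eq_integral do rewrite (funepos_comp h f) /=.
  under [RHS]eq_integral do rewrite (funepos_comp h g) /=.
  by apply: (ge0 (h^\+%E)) => //; exact: measurable_funepos.
under eq_integral do rewrite (funeneg_comp h f) /=.
under [RHS]eq_integral do rewrite (funeneg_comp h g) /=.
by apply: (ge0 (h^\-%E)) => //; exact: measurable_funeneg.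
Qed.

(** A measure that factorizes on rectangles is the product measure. The marginals are taken from [f]
    and [g], possibly different from [f'] and [g'], so that the statement also serves to compare two
    independent pairs with equal marginals. *)
Lemma pair_law_product {d1 d2} {T1 : measurableType d1} {T2 : measurableType d2}
    (f f' : {mfun T >-> T1}) (g g' : {mfun T >-> T2}) :
  (forall A B, measurable A -> measurable B ->
     P (f' @^-1` A `&` g' @^-1` B) = (P (f @^-1` A) * P (g @^-1` B))%E) ->
  forall A, measurable A ->
    (distribution P f \x distribution P g)%E A = P ((fun w => (f' w, g' w)) @^-1` A).
Proof.
move=> fg A mA.
have mfg : measurable_fun setT (fun w => (f' w, g' w)) by exact: measurable_fun_pair.
pose h : {mfun T >-> (T1 * T2)%type} := mfun_Sub (mem_set mfg).
apply: (@product_measure_unique _ _ _ _ _ (distribution P f) (distribution P g)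
   (distribution P h)) => //.
Qed.

(** Fubini on the product of the two laws, which is the joint law by [pair_law_product]. *)
Lemma indep_integralM (f g : {mfun T >-> R}) :
  (forall A B, measurable A -> measurable B ->
     P (f @^-1` A `&` g @^-1` B) = (P (f @^-1` A) * P (g @^-1` B))%E) ->
  P.-integrable setT (EFin \o f) -> P.-integrable setT (EFin \o g) ->
  P.-integrable setT (EFin \o (fun w => f w * g w)) ->
  Ex P (fun w => f w * g w) = Ex P f * Ex P g.
Proof.
move=> fg If Ig Ifg.
have mfg : measurable_fun setT (fun w => (f w, g w)) by exact: measurable_fun_pair.
pose h : {mfun T >-> (R * R)%type} := mfun_Sub (mem_set mfg).
pose m : R * R -> \bar R := fun x => (x.1 * x.2)%:E.
have mm : measurable_fun [set: (R * R)%type] m.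
  by apply/measurable_EFinP; apply: measurable_funM; [exact: measurable_fst|exact: measurable_snd].
have Em A : measurable A -> (distribution P f \x distribution P g)%E A = distribution P h A.
  exact: pair_law_product.
have Im : (distribution P h).-integrable setT m.
  exact: (@integrable_pushforward _ _ _ _ _ h (measurable_funPT h) P setT m mm).
have Im' : (distribution P f \x distribution P g)%E.-integrable setT m.
  apply/integrableP; split=> //; case/integrableP : Im => _; apply: le_lt_trans.
  by rewrite (@eq_measure_integral _ _ _ _ (distribution P h)) // => A mA _; exact: Em.
rewrite /Ex /Rintegral.
have -> : (\int[P]_w (f w * g w)%:E = \int[distribution P h]_x m x)%E.
  rewrite (@integral_pushforward _ _ _ _ _ h (measurable_funPT h) P setT m mm) //.
have -> : (\int[distribution P h]_x m x = \int[distribution P f \x distribution P g]_x m x)%E.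
  by apply: eq_measure_integral => A mA _; apply/esym/Em.
rewrite -(integral12_prod_meas1 Im').
have idE (u : {mfun T >-> R}) : P.-integrable setT (EFin \o u) ->
    (distribution P u).-integrable setT EFin /\
    (\int[distribution P u]_x x%:E = (Ex P u)%:E)%E.
  move=> Iu; split.
    exact: (@integrable_pushforward _ _ _ _ _ u (measurable_funPT u) P setT EFin).
  rewrite (@integral_pushforward _ _ _ _ _ u (measurable_funPT u) P setT EFin) //.
  by rewrite /Ex /Rintegral fineK //; exact: integrable_fin_num.
have [If1 If2] := idE f If; have [Ig1 Ig2] := idE g Ig.
(* The inner integral of [x * y] over the law of [g] is [x * Ex P g]. *)
transitivity (fine (\int[distribution P f]_x (x%:E * (Ex P g)%:E))%E).
  congr fine; apply: eq_integral => x _; rewrite -Ig2 -integralZl //.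
by rewrite integralZr // If2.
Qed.

End Laws.

(** * Second moments *)

Section Moments.
Context {dsp : measure_display} {T : measurableType dsp} {R : realType}.
Variable P : probability T R.
Local Notation intg f := (P.-integrable setT (EFin \o f)).

Lemma intg_le (f g : T -> R) : measurable_fun setT f ->
  (forall w, `|f w| <= g w) -> intg g -> intg f.
Proof.
move=> mf fg; apply: le_integrable => //; first exact/measurable_EFinP.
by move=> w _ /=; rewrite lee_fin (le_trans (fg w)) // ler_norm.
Qed.

Lemma intgD (f g : T -> R) : intg f -> intg g -> intg (fun w => f w + g w).
Proof. by move=> If Ig; have := integrableD measurableT If Ig. Qed.

Lemma intgB (f g : T -> R) : intg f -> intg g -> intg (fun w => f w - g w).
Proof. by move=> If Ig; have := integrableB measurableT If Ig. Qed.

Lemma intgZ (c : R) (f : T -> R) : intg f -> intg (fun w => c * f w).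
Proof. by move=> If; have := integrableZl measurableT c If. Qed.

Lemma intg_cst (c : R) : intg (fun=> c).
Proof. exact: finite_measure_integrable_cst. Qed.

Lemma intg_sum (I : Type) (s : seq I) (f : I -> T -> R) :
  (forall i, intg (f i)) -> intg (fun w => \sum_(i <- s) f i w).
Proof.
move=> If; elim: s => [|i s IH].
  by under eq_fun do rewrite big_nil; exact: intg_cst.
by under eq_fun do rewrite big_cons; exact: intgD.
Qed.

Lemma ExD (f g : T -> R) : intg f -> intg g ->
  Ex P (fun w => f w + g w) = Ex P f + Ex P g.
Proof. by move=> If Ig; rewrite /Ex RintegralD. Qed.

Lemma ExB (f g : T -> R) : intg f -> intg g ->
  Ex P (fun w => f w - g w) = Ex P f - Ex P g.
Proof. by move=> If Ig; rewrite /Ex RintegralB. Qed.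

Lemma ExZ (c : R) (f : T -> R) : intg f -> Ex P (fun w => c * f w) = c * Ex P f.
Proof. by move=> If; rewrite /Ex RintegralZl. Qed.

Lemma Ex_cst (c : R) : Ex P (fun=> c) = c.
Proof. by have PT := @probability_setT _ _ _ P; rewrite /Ex Rintegral_cst // [X in fine X]PT mulr1. Qed.

Lemma Ex_sum (I : Type) (s : seq I) (f : I -> T -> R) :
  (forall i, intg (f i)) ->
  Ex P (fun w => \sum_(i <- s) f i w) = \sum_(i <- s) Ex P (f i).
Proof.
move=> If; elim: s => [|i s IH].
  by rewrite big_nil; under eq_fun do rewrite big_nil; rewrite Ex_cst.
rewrite big_cons -IH -ExD //; last exact: intg_sum.
by congr (Ex P _); apply/funext => w; rewrite big_cons.
Qed.

Lemma Ex_le (f g : T -> R) : intg f -> intg g -> (forall w, f w <= g w) ->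
  Ex P f <= Ex P g.
Proof. by move=> If Ig fg; exact: le_Rintegral. Qed.

Lemma Ex_ge0 (f : T -> R) : (forall w, 0 <= f w) -> 0 <= Ex P f.
Proof. by move=> f0; exact: Rintegral_ge0. Qed.

Definition L2 (f : T -> R) := measurable_fun setT f /\ intg (fun w => f w ^+ 2).

Lemma L2_intgM {f g : T -> R} : L2 f -> L2 g -> intg (fun w => f w * g w).
Proof.
move=> [mf If] [mg Ig].
apply: (@intg_le _ (fun w => f w ^+ 2 + g w ^+ 2)).
- exact: measurable_funM.
- by move=> w; rewrite ler_norml; apply/andP; split; nra.
- exact: intgD.
Qed.

Lemma L2_cst (c : R) : L2 (fun=> c).
Proof. by split => //; exact: intg_cst. Qed.

Lemma L2_intg {f : T -> R} : L2 f -> intg f.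
Proof.
move=> Lf; have := L2_intgM Lf (L2_cst 1).
by under eq_fun do rewrite mulr1.
Qed.

Lemma L2_D {f g : T -> R} : L2 f -> L2 g -> L2 (fun w => f w + g w).
Proof.
move=> Lf Lg; have [mf If] := Lf; have [mg Ig] := Lg; split; first exact: measurable_funD.
have -> : (fun w => (f w + g w) ^+ 2) = (fun w => f w ^+ 2 + 2 * (f w * g w) + g w ^+ 2).
  by apply/funext => w; ring.
by do 2 (apply: intgD => //); apply: intgZ; exact: L2_intgM.
Qed.

Lemma L2_Z (c : R) {f : T -> R} : L2 f -> L2 (fun w => c * f w).
Proof.
move=> [mf If]; split; first exact: measurable_funM.
by under eq_fun do rewrite exprMn; exact: intgZ.
Qed.

Lemma L2_B {f g : T -> R} : L2 f -> L2 g -> L2 (fun w => f w - g w).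
Proof.
by move=> Lf Lg; have := L2_D Lf (L2_Z (-1) Lg); under eq_fun do rewrite mulN1r.
Qed.

Lemma L2_sum (I : Type) (s : seq I) (f : I -> T -> R) :
  (forall i, L2 (f i)) -> L2 (fun w => \sum_(i <- s) f i w).
Proof.
move=> Lf; elim: s => [|i s IH].
  by under eq_fun do rewrite big_nil; exact: L2_cst.
by under eq_fun do rewrite big_cons; exact: L2_D.
Qed.

(** The centred form shows that variances are nonnegative, and it is what Markov's inequality bounds
    in [Chebyshev]. *)
Lemma Cov_centered {f g : T -> R} : L2 f -> L2 g ->
  Cov P f g = Ex P (fun w => (f w - Ex P f) * (g w - Ex P g)).
Proof.
move=> Lf Lg; have If := L2_intg Lf; have Ig := L2_intg Lg.
have -> : (fun w => (f w - Ex P f) * (g w - Ex P g)) =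
    (fun w => f w * g w - Ex P g * f w - Ex P f * g w + Ex P f * Ex P g).
  by apply/funext => w; ring.
rewrite ExD; [|by do 2 (apply: intgB; last exact: intgZ); exact: L2_intgM|exact: intg_cst].
rewrite ExB; [|by apply: intgB; [exact: L2_intgM|exact: intgZ]|exact: intgZ].
rewrite ExB; [|exact: L2_intgM|exact: intgZ].
by rewrite Ex_cst !ExZ // /Cov; ring.
Qed.

Lemma CovC (f g : T -> R) : Cov P f g = Cov P g f.
Proof.
by rewrite /Cov mulrC; congr (Ex P _ - _); last first; apply/funext => w; rewrite mulrC.
Qed.

Lemma Var_ge0 {f : T -> R} : L2 f -> 0 <= Var P f.
Proof. by move=> Lf; rewrite /Var Cov_centered //; apply: Ex_ge0 => w; rewrite -expr2 sqr_ge0. Qed.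

Lemma Var_le {f : T -> R} : L2 f -> Var P f <= Ex P (fun w => f w ^+ 2).
Proof.
move=> Lf; rewrite /Var /Cov.
under eq_fun do rewrite -expr2.
by rewrite gerBl -expr2 sqr_ge0.
Qed.

Lemma Var_sum (I : Type) (s : seq I) (f : I -> T -> R) : (forall i, L2 (f i)) ->
  Var P (fun w => \sum_(i <- s) f i w) = \sum_(i <- s) \sum_(j <- s) Cov P (f i) (f j).
Proof.
move=> Lf; have If i : intg (f i) by exact: L2_intg.
rewrite /Var /Cov Ex_sum // mulr_suml.
under [fun w => _]eq_fun do rewrite mulr_suml.
rewrite Ex_sum; last first.
  by move=> i; apply: L2_intgM => //; exact: L2_sum.
rewrite -sumrB; apply: eq_bigr => i _; rewrite sumrB; congr (_ - _); last by rewrite mulr_sumr.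
under eq_fun do rewrite mulr_sumr.
by rewrite Ex_sum // => j; exact: L2_intgM.
Qed.

(** When [Var P g = 0], the variance of [f + t * g] is affine in [t]; being nonnegative for every
    [t], it has slope zero. *)
Lemma Var_eq0_Cov {f g : T -> R} : L2 f -> L2 g -> Var P g = 0 -> Cov P f g = 0.
Proof.
move=> Lf Lg g0.
have h t : 0 <= Var P f + 2 * t * Cov P f g.
  have := Var_ge0 (L2_D Lf (L2_Z t Lg)).
  suff -> : Var P (fun w => f w + t * g w) =
      Var P f + 2 * t * Cov P f g + t ^+ 2 * Var P g by rewrite g0 mulr0 addr0.
  rewrite /Var /Cov ExD ?ExZ; [|exact: L2_intg..|by apply: intgZ; exact: L2_intg].
  have -> : (fun w => (f w + t * g w) * (f w + t * g w)) =
    (fun w => f w * f w + (2 * t) * (f w * g w) + (t ^+ 2) * (g w * g w)).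
    by apply/funext => w; ring.
  rewrite ExD; [|apply: intgD; [|apply: intgZ]|apply: intgZ]; try exact: L2_intgM.
  rewrite ExD; [|exact: L2_intgM|by apply: intgZ; exact: L2_intgM].
  by rewrite !ExZ; [ring|exact: L2_intgM..].
apply/eqP/negP => /negP c0.
(* This value of [t] makes the affine function equal to [-1]. *)
have := h (- (Var P f + 1) / (2 * Cov P f g)).
have -> : Var P f + 2 * (- (Var P f + 1) / (2 * Cov P f g)) * Cov P f g = -1.
  by field.
by rewrite ler0N1.
Qed.

(** If a variance vanishes, [Corr] is [0] by the convention [x / 0 = 0], and the covariance has to
    vanish too. Otherwise the covariance is [Corr] times the root of the product of the variances, a
    root at most [C]. *)
Lemma Cov_le_Corr {f g : T -> R} (C : R) : L2 f -> L2 g ->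
  Var P f <= C -> Var P g <= C -> `|Cov P f g| <= C * `|Corr P f g|.
Proof.
move=> Lf Lg fC gC; have f0 := Var_ge0 Lf; have g0 := Var_ge0 Lg.
have [fg0|fg0] := eqVneq (Var P f * Var P g) 0.
  have -> : Cov P f g = 0.
    move/eqP : fg0; rewrite mulf_eq0 => /orP[] /eqP v0; last exact: Var_eq0_Cov.
    by rewrite CovC; exact: Var_eq0_Cov.
  by rewrite normr0 mulr_ge0 // (le_trans f0).
have s0 : 0 < Num.sqrt (Var P f * Var P g).
  by rewrite sqrtr_gt0 lt_neqAle eq_sym fg0 mulr_ge0.
have -> : Cov P f g = Num.sqrt (Var P f * Var P g) * Corr P f g.
  by rewrite /Corr mulrC divfK // gt_eqF.
rewrite normrM ler_wpM2r // gtr0_norm //.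
rewrite -(ger0_norm (le_trans f0 fC)) -sqrtr_sqr ler_wsqrtr // expr2.
exact: ler_pM.
Qed.

(** Markov's inequality for the square of the centred variable. *)
Lemma Chebyshev {f : T -> R} (e : R) : L2 f -> 0 < e ->
  (P [set w | (e <= `|f w - Ex P f|)%R] <= (e ^- 2 * Var P f)%:E)%E.
Proof.
move=> Lf e0; have [mf If] := Lf.
have Lc := L2_B Lf (L2_cst (Ex P f)); have [mc Ic] := Lc.
pose A := [set w | e <= `|f w - Ex P f|].
have mA : measurable A.
  rewrite -[A]setTI; apply: (measurable_fun_ler (measurable_cst e)) => //.
  exact: measurableT_comp.
have -> : Var P f = Ex P (fun w => (f w - Ex P f) ^+ 2).
  by rewrite /Var Cov_centered //; under eq_fun do rewrite -expr2.
pose X : {mfun T >-> R} := mfun_Sub (mem_set mc).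
have := @markov _ _ _ P X (fun x => x ^+ 2) e e0 (exprn_measurable 2) _ _.
rewrite unlock => /(_ (fun r _ => sqr_ge0 r)) M.
rewrite -(@lee_pmul2l _ (e ^+ 2)%:E) ?lte_fin ?exprn_gt0 //.
rewrite -EFinM mulrA mulfV ?mul1r ?expf_neq0 ?gt_eqF //.
apply: le_trans (M _) _.
  by move=> x y; rewrite !nnegrE => x0 y0 xy; rewrite lerXn2r ?nnegrE.
rewrite /Ex /Rintegral fineK; last exact: integrable_fin_num.
rewrite le_eqVlt; apply/orP; left; apply/eqP; apply: eq_integral => w _ /=.
by rewrite real_normK // num_real.
Qed.

(** Chebyshev for the sum, whose variance is the double sum of covariances: the [d] diagonal terms
    are at most [C] each, and the others are controlled by the correlations that (A2) makes
    small. *)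
Lemma concentration (d : nat) (V : 'I_d -> T -> R) (C e : R) :
  (forall r, L2 (V r)) -> (forall r, Var P (V r) <= C) -> 0 < e ->
  (P [set w | (e <= `|\sum_r V r w - \sum_r Ex P (V r)|)%R] <=
   (e ^- 2 * (C * d%:R + C * \sum_r \sum_(s | s != r) `|Corr P (V r) (V s)|))%:E)%E.
Proof.
move=> LV VC e0.
rewrite -Ex_sum; last by move=> r; exact: L2_intg.
have := Chebyshev e (L2_sum _ (index_enum _) V LV) e0; move=> /le_trans; apply.
rewrite lee_fin ler_wpM2l ?invr_ge0 ?sqr_ge0 // Var_sum //.
have -> : C * d%:R = \sum_(r < d) C by rewrite sumr_const card_ord mulr_natr.
rewrite mulr_sumr -big_split /=; apply: ler_sum => r _.
rewrite (bigD1 r) //=; apply: lerD; first exact: VC.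
rewrite mulr_sumr; apply: ler_sum => s _.
by apply: le_trans (ler_norm _) _; exact: Cov_le_Corr.
Qed.

End Moments.

(** * Squared distances of random vectors *)

Section Vectors.
Context {R : realType}.

Definition Rd_gen (d : nat) : set (set ('I_d -> R)) :=
  \bigcup_(r in [set: 'I_d]) [set (fun x : 'I_d -> R => x r) @^-1` B | B in measurable].

(** The measurable sets of this type are those of [Rd_meas] by conversion, so that random vectors
    have laws and product measures. *)
Definition Rd (d : nat) := g_sigma_algebraType (Rd_gen d).

(** The squared Euclidean distance, kept as a sum over coordinates so that [concentration]
    applies. *)
Definition sqd {d : nat} (x y : 'I_d -> R) : R := \sum_(r < d) (x r - y r) ^+ 2.

Lemma measurable_coord (d : nat) (r : 'I_d) :
  measurable_fun [set: Rd d] (fun x : Rd d => x r).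
Proof.
move=> _ B mB; rewrite setTI; apply: sub_sigma_algebra; exists r => //.
by exists B.
Qed.

Lemma measurable_sqd (d : nat) :
  measurable_fun [set: (Rd d * Rd d)%type] (fun x : Rd d * Rd d => sqd x.1 x.2).
Proof.
apply: measurable_sum => r; apply: measurable_funX; apply: measurable_funB.
  exact: (measurableT_comp (measurable_coord d r) measurable_fst).
exact: (measurableT_comp (measurable_coord d r) measurable_snd).
Qed.

Context {dsp : measure_display} {T : measurableType dsp}.
Variable P : probability T R.

Lemma measurable_vec (d : nat) (Y : T -> Rd d) :
  (forall r, measurable_fun setT (fun w => Y w r)) -> measurable_fun setT Y.
Proof.
move=> mY. refine (@measurability _ _ T (Rd d) setT Y (Rd_gen d) _ _) => //.
move=> _ [_ [r _ [B mB <-]] <-].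
exact: (mY r measurableT B mB).
Qed.

Lemma measurable_sqd_vec (d : nat) (Y Y' : T -> 'I_d -> R) :
  (forall r, measurable_fun setT (fun w => Y w r)) ->
  (forall r, measurable_fun setT (fun w => Y' w r)) ->
  measurable_fun setT (fun w => sqd (Y w) (Y' w)).
Proof.
by move=> mY mY'; apply: measurable_sum => r; apply: measurable_funX; exact: measurable_funB.
Qed.

Definition indep_pair (d : nat) (Y Y' : T -> 'I_d -> R) :=
  forall A B, Rd_meas A -> Rd_meas B ->
    P (Y @^-1` A `&` Y' @^-1` B) = (P (Y @^-1` A) * P (Y' @^-1` B))%E.

Lemma mutually_indep_pair (K : finType) (d : nat) (Y : K -> T -> 'I_d -> R) (a b : K) :
  mutually_indep P Y -> a != b -> indep_pair d (Y a) (Y b).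
Proof.
move=> iY ab A B mA mB.
have mT : Rd_meas [set: 'I_d -> R] by exact: (@measurableT _ (Rd d)).
(* All other variables are constrained to the whole space, where they contribute factors [1]. *)
pose C k : set ('I_d -> R) := if k == a then A else if k == b then B else setT.
have mC k : Rd_meas (C k) by rewrite /C; case: ifP => // _; case: ifP.
have := iY C mC.
have Ca : C a = A by rewrite /C eqxx.
have Cb : C b = B by rewrite /C eq_sym (negbTE ab) eqxx.
rewrite (bigD1 a) //= (bigD1 b) /=; last by rewrite eq_sym.
rewrite big1; last first.
  move=> k /andP[ka kb]; rewrite /C (negbTE ka) (negbTE kb) preimage_setT.
  exact: probability_setT.
rewrite mule1 Ca Cb => <-; congr (P _); apply/seteqP; split => w.
  move=> [Aw Bw] k _; rewrite /C /=.
  by case: eqP => [->|_] //; case: eqP => [->|].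
move=> Cw; split; first by have := Cw a I; rewrite Ca.
by have := Cw b I; rewrite Cb.
Qed.

(** The integrals are extended-real, so that the fourth-moment bound can be transported before any
    integrability is known. *)
Lemma same_law_Ex (d : nat) (Y Y' : T -> 'I_d -> R) (h : R -> R) (r : 'I_d) :
  (forall r, measurable_fun setT (fun w => Y w r)) ->
  (forall r, measurable_fun setT (fun w => Y' w r)) ->
  same_law P Y Y' -> measurable_fun setT h ->
  (\int[P]_w (h (Y w r))%:E = \int[P]_w (h (Y' w r))%:E)%E.
Proof.
move=> mY mY' YY' mh.
apply: (@eq_law_integral _ _ _ P _ _ (fun w => Y w r) (fun w => Y' w r) (EFin \o h)) => //.
  exact/measurable_EFinP.
move=> B mB; apply: (YY' ((fun x => x r) @^-1` B)).
by apply: sub_sigma_algebra; exists r => //; exists B.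
Qed.

(** Independence makes each joint law the product of its marginals, so equal marginals give equal
    joint laws. *)
Lemma sqd_law (d : nat) (Y1 Y2 Y1' Y2' : T -> 'I_d -> R) (S : set R) :
  (forall r, measurable_fun setT (fun w => Y1 w r)) ->
  (forall r, measurable_fun setT (fun w => Y2 w r)) ->
  (forall r, measurable_fun setT (fun w => Y1' w r)) ->
  (forall r, measurable_fun setT (fun w => Y2' w r)) ->
  indep_pair d Y1 Y2 -> indep_pair d Y1' Y2' ->
  same_law P Y1 Y1' -> same_law P Y2 Y2' -> measurable S ->
  P [set w | S (sqd (Y1 w) (Y2 w))] = P [set w | S (sqd (Y1' w) (Y2' w))].
Proof.
move=> m1 m2 m1' m2' i12 i12' l1 l2 mS.
pose f : {mfun T >-> Rd d} := mfun_Sub (mem_set (measurable_vec d Y1 m1)).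
pose g : {mfun T >-> Rd d} := mfun_Sub (mem_set (measurable_vec d Y2 m2)).
pose f' : {mfun T >-> Rd d} := mfun_Sub (mem_set (measurable_vec d Y1' m1')).
pose g' : {mfun T >-> Rd d} := mfun_Sub (mem_set (measurable_vec d Y2' m2')).
pose A := (fun x : Rd d * Rd d => sqd x.1 x.2) @^-1` S.
have mA : measurable A by rewrite -[A]setTI; exact: measurable_sqd.
have E1 := pair_law_product P f f g g i12 A mA.
have E2 : (distribution P f \x distribution P g)%E A = P ((fun w => (f' w, g' w)) @^-1` A).
  apply: pair_law_product => // B C mB mC.
  by rewrite [LHS]i12' // -(l1 B mB) -(l2 C mC).
by rewrite [LHS](esym E1) E2.
Qed.

(** After expansion of the square, independence factorizes the cross term. *)
Lemma indep_Ex_sqr (d : nat) (Y X : T -> 'I_d -> R) (r : 'I_d) :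
  L2 P (fun w => Y w r) -> L2 P (fun w => X w r) -> indep_pair d Y X ->
  Ex P (fun w => (Y w r - X w r) ^+ 2) =
  Var P (fun w => Y w r) + Var P (fun w => X w r) +
  (Ex P (fun w => Y w r) - Ex P (fun w => X w r)) ^+ 2.
Proof.
move=> LY LX iYX; have [mY IY] := LY; have [mX IX] := LX.
have IYX := L2_intgM P LY LX.
have -> : (fun w => (Y w r - X w r) ^+ 2) =
   (fun w => (Y w r ^+ 2 + X w r ^+ 2) - 2 * (Y w r * X w r)).
  by apply/funext => w; ring.
rewrite ExB ?ExD ?ExZ //; [|exact: intgD|exact: intgZ].
pose f : {mfun T >-> R} := mfun_Sub (mem_set mY).
pose g : {mfun T >-> R} := mfun_Sub (mem_set mX).
have -> : Ex P (fun w => Y w r * X w r) = Ex P (fun w => Y w r) * Ex P (fun w => X w r).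
  apply: (indep_integralM P f g) => //; [|exact: (L2_intg P LY)|exact: (L2_intg P LX)].
  move=> A B mA mB; apply: (iYX ((fun x => x r) @^-1` A) ((fun x => x r) @^-1` B)).
    by apply: sub_sigma_algebra; exists r => //; exists A.
  by apply: sub_sigma_algebra; exists r => //; exists B.
rewrite /Var /Cov; under [in RHS]eq_fun do rewrite -expr2.
under [X in _ = _ + (Ex P X - _) + _]eq_fun do rewrite -expr2.
by ring.
Qed.

(** The bound is on the extended-real integral and thus entails integrability, whereas [Ex] reads an
    infinite integral as [0]. *)
Definition L4 (M : R) (f : T -> R) :=
  measurable_fun setT f /\ (\int[P]_w (f w ^+ 4)%:E <= M%:E)%E.

Lemma L4_intg {M : R} {f : T -> R} : L4 M f ->
  P.-integrable setT (EFin \o (fun w => f w ^+ 4)).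
Proof.
move=> [mf fM]; apply/integrableP; split.
  by apply/measurable_EFinP; exact: measurable_funX.
under eq_integral => w _.
  rewrite /= ger0_norm; last by rewrite -[4%N]/(2 * 2)%N exprM sqr_ge0.
  over.
exact: le_lt_trans fM (ltry _).
Qed.

Lemma L4_Ex {M : R} {f : T -> R} : L4 M f -> Ex P (fun w => f w ^+ 4) <= M.
Proof.
move=> Lf; have [_ fM] := Lf; rewrite -lee_fin /Ex /Rintegral fineK //.
exact: integrable_fin_num (L4_intg Lf).
Qed.

Lemma L4_L2 {M : R} {f : T -> R} : L4 M f -> L2 P f.
Proof.
move=> Lf; have [mf fM] := Lf; split => //.
apply: (intg_le P _ (fun w => 1 + f w ^+ 4)).
- exact: measurable_funX.
- by move=> w; rewrite ger0_norm ?sqr_ge0 //; nra.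
- by apply: intgD; [exact: intg_cst|exact: L4_intg Lf].
Qed.

(** The constant comes from [(a - b)^4 <= 8 * (a^4 + b^4)], which combines
    [(a - b)^2 <= 2 * (a^2 + b^2)] with [(a^2 + b^2)^2 <= 2 * (a^4 + b^4)]; two fourth moments at
    most [M] then give [16 * M]. *)
Lemma L4_sqrB {M : R} {f g : T -> R} : L4 M f -> L4 M g ->
  L2 P (fun w => (f w - g w) ^+ 2) /\ Var P (fun w => (f w - g w) ^+ 2) <= 16 * M.
Proof.
move=> Lf Lg; have [mf _] := Lf; have [mg _] := Lg.
have If := L4_intg Lf; have Ig := L4_intg Lg.
have I : P.-integrable setT (EFin \o (fun w => 8 * (f w ^+ 4 + g w ^+ 4))).
  by apply: intgZ; exact: intgD.
have le8 w : ((f w - g w) ^+ 2) ^+ 2 <= 8 * (f w ^+ 4 + g w ^+ 4).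
  have h : 0 <= (f w + g w) ^+ 2 by exact: sqr_ge0.
  have h2 : (f w - g w) ^+ 2 <= 2 * (f w ^+ 2 + g w ^+ 2) by nra.
  have h3 : ((f w - g w) ^+ 2) ^+ 2 <= (2 * (f w ^+ 2 + g w ^+ 2)) ^+ 2.
    by rewrite lerXn2r ?nnegrE ?sqr_ge0 // (le_trans _ h2) // sqr_ge0.
  have h4 := sqr_ge0 (f w ^+ 2 - g w ^+ 2).
  apply: (le_trans h3); nra.
have L : L2 P (fun w => (f w - g w) ^+ 2).
  split; first by apply: measurable_funX; exact: measurable_funB.
  apply: (intg_le P _ (fun w => 8 * (f w ^+ 4 + g w ^+ 4))) => //.
    by do 2 apply: measurable_funX; exact: measurable_funB.
  by move=> w; rewrite ger0_norm ?sqr_ge0.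
split => //; apply: (le_trans (Var_le P L)).
apply: (le_trans (Ex_le P _ _ _ I le8)); first by case: L.
rewrite ExZ; last exact: intgD.
rewrite ExD // (_ : 16 * M = 8 * (M + M)); last by ring.
by rewrite ler_pM2l // lerD //; exact: L4_Ex.
Qed.

(** [X'] stands for a test observation of the class of [X]: moment bounds are given for it and pass
    to [X] through the common law. The centre is the mean of the squared distance, computed
    coordinatewise by [indep_Ex_sqr]. *)
Lemma sqd_deviation (d : nat) (Y X X' : T -> 'I_d -> R) (M e : R) :
  (forall r, L4 M (fun w => Y w r)) -> (forall r, L4 M (fun w => X' w r)) ->
  (forall r, measurable_fun setT (fun w => X w r)) ->
  same_law P X X' -> indep_pair d Y X -> 0 < e ->
  (P [set w | (e <= `|sqd (Y w) (X w) -
       (\sum_r Var P (fun w => Y w r) + \sum_r Var P (fun w => X' w r) +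
        \sum_r (Ex P (fun w => Y w r) - Ex P (fun w => X' w r)) ^+ 2)|)%R] <=
   (e ^- 2 * (16 * M * d%:R + 16 * M * \sum_r \sum_(s | s != r)
      `|Corr P (fun w => (Y w r - X w r) ^+ 2) (fun w => (Y w s - X w s) ^+ 2)|))%:E)%E.
Proof.
move=> LY LX' mX XX' iYX e0.
have mX' r : measurable_fun setT (fun w => X' w r) by have [] := LX' r.
have law h r : measurable_fun setT h ->
    (\int[P]_w (h (X w r))%:E = \int[P]_w (h (X' w r))%:E)%E by exact: same_law_Ex.
have LX r : L4 M (fun w => X w r).
  split => //; have m4 : measurable_fun setT (fun x : R => x ^+ 4).
    exact: exprn_measurable.
  by rewrite (law _ r m4); have [] := LX' r.
have EX r : Ex P (fun w => X' w r) = Ex P (fun w => X w r).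
  by rewrite /Ex /Rintegral (law id).
have VX r : Var P (fun w => X' w r) = Var P (fun w => X w r).
  rewrite /Var /Cov EX; congr (_ - _); rewrite /Ex /Rintegral.
  by rewrite (law (fun x => x * x)) //; exact: measurable_funM.
have LV r : L2 P (fun w => (Y w r - X w r) ^+ 2) by have [] := L4_sqrB (LY r) (LX r).
have VV r : Var P (fun w => (Y w r - X w r) ^+ 2) <= 16 * M.
  by have [] := L4_sqrB (LY r) (LX r).
have -> : \sum_r Var P (fun w => Y w r) + \sum_r Var P (fun w => X' w r) +
    \sum_r (Ex P (fun w => Y w r) - Ex P (fun w => X' w r)) ^+ 2 =
    \sum_(r < d) Ex P (fun w => (Y w r - X w r) ^+ 2).
  rewrite -!big_split /=; apply: eq_bigr => r _; rewrite VX EX indep_Ex_sqr //.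
    exact: L4_L2 (LY r).
  exact: L4_L2 (LX r).
exact: (concentration P d (fun r w => (Y w r - X w r) ^+ 2) _ e LV VV e0).
Qed.

End Vectors.

(** * Convergence in probability as convergence along a filter *)

Section HighProbability.
Context {R : realType} {dsp : nat -> measure_display}
  {Om : forall d : nat, measurableType (dsp d)}.
Variable P : forall d : nat, probability (Om d) R.

(** Pairing the dimension with the outcome gives one filter although the probability space changes
    with [d]. Measurability is asked of the exceptional sets [B d], so [E] may be arbitrary. *)
Definition whp : set_system {d : nat & Om d} := fun E =>
  exists B : forall d, set (Om d),
    [/\ forall d, measurable (B d), (fun d => P d (B d)) @ \oo --> 0%E
      & forall d w, ~ B d w -> E (existT _ d w)].

Global Instance whp_filter : Filter whp.
Proof.
split.
- exists (fun d => set0); split => //; under eq_fun do rewrite measure0; exact: cvg_cst.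
(* Union bound: an intersection can fail only on the union of the exceptional sets. *)
- move=> E F [B [mB B0 BE]] [C [mC C0 CF]]; exists (fun d => B d `|` C d); split.
  + by move=> d; exact: measurableU.
  + apply: (@squeeze_cvge _ _ _ _ (fun=> 0%E) _ (fun d => P d (B d) + P d (C d))%E).
    * by apply: nearW => d; rewrite measure_ge0 /=; exact: measureU2.
    * exact: cvg_cst.
    * by rewrite -[0%E]adde0; apply: cvgeD.
  + by move=> d w /not_orP[Bw Cw]; split; [exact: BE|exact: CF].
- move=> E F EF [B [mB B0 BE]]; exists B; split => // d w Bw; exact/EF/BE.
Qed.

Lemma whpS (E G : {d : nat & Om d} -> Prop) : (forall p, E p -> G p) ->
  (\forall p \near whp, E p) -> \forall p \near whp, G p.
Proof. exact: filterS. Qed.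

(** The way back from the filter to probabilities. Monotonicity of [P d] takes a measurable [E d],
    whence the measurability of the classification events below. *)
Lemma whp_prob0 (E : forall d, set (Om d)) : (forall d, measurable (E d)) ->
  (\forall p \near whp, ~ E (tag p) (tagged p)) ->
  (fun d => P d (E d)) @ \oo --> 0%E.
Proof.
move=> mE [B [mB B0 BE]].
apply: (@squeeze_cvge _ _ _ _ (fun=> 0%E) _ (fun d => P d (B d))) => //.
  apply: nearW => d; rewrite measure_ge0 /=; apply: le_measure; rewrite ?inE //.
  by move=> w Ew; apply: contrapT => /BE.
exact: cvg_cst.
Qed.

Lemma whp_tag : (@tag nat Om) @ whp --> \oo.
Proof.
(* The exceptional set is everything below dimension [N] and empty from [N] on. *)
move=> A [N _ NA]; exists (fun d => if (d < N)%N then setT else set0); split.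
- by move=> d; case: ifP.
- apply: cvg_near_cst; exists N => // d /= Nd.
  by rewrite ltnNge Nd /= measure0.
- move=> d w; case: ltnP => //= Nd _; exact: NA.
Qed.

Lemma whp_cvg_det (u : nat -> R) (c : R) : u @ \oo --> c ->
  (fun p : {d : nat & Om d} => u (tag p)) @ whp --> c.
Proof. by move=> uc; exact: cvg_comp whp_tag uc. Qed.

Lemma whp_cvg (f : forall d, Om d -> R) (c : R) :
  (forall d, measurable_fun setT (f d)) ->
  (forall e, 0 < e -> (fun d => P d [set w | e <= `|f d w - c|]) @ \oo --> 0%E) ->
  (fun p : {d : nat & Om d} => f (tag p) (tagged p)) @ whp --> c.
Proof.
move=> mf fc; apply/cvgrPdist_lt => e e0.
exists (fun d => [set w | e <= `|f d w - c|]); split.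
- move=> d; rewrite -[X in measurable X]setTI.
  apply: (measurable_fun_ler (measurable_cst e)) => //.
  by apply: measurableT_comp => //; exact: measurable_funB.
- exact: fc.
- by move=> d w /negP; rewrite -ltNge distrC.
Qed.

(** In the applications [S d] is a squared distance, [m d] its mean and [s d] the sum of absolute
    correlations. At threshold [e * d] the deviation bound becomes
    [e ^- 2 * (C / d + C * s d / d ^ 2)], which tends to [0]. *)
Lemma whp_cvg_average (S : forall d, Om d -> R) (m s : nat -> R) (C c : R) :
  (forall d, measurable_fun setT (S d)) ->
  (forall d e, 0 < e ->
    (P d [set w | (e <= `|S d w - m d|)%R] <= (e ^- 2 * (C * d%:R + C * s d))%:E)%E) ->
  (fun d => s d / d%:R ^+ 2) @ \oo --> (0 : R) ->
  (fun d => m d / d%:R) @ \oo --> c ->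
  (fun p : {d : nat & Om d} => S (tag p) (tagged p) / (tag p)%:R) @ whp --> c.
Proof.
move=> mS SP s0 mc.
have mZ d : measurable_fun setT (fun w => (S d w - m d) / d%:R).
  by apply: measurable_funM => //; exact: measurable_funB.
have : (fun p : {d : nat & Om d} => (S (tag p) (tagged p) - m (tag p)) / (tag p)%:R) @ whp --> (0 : R).
  apply: (whp_cvg (fun d w => (S d w - m d) / d%:R) 0 mZ) => e e0.
  have b0 : (fun d => (e ^- 2 * (C * d%:R^-1 + C * (s d / d%:R ^+ 2)))%:E) @ \oo --> 0%E.
    apply: cvg_EFin; first exact: nearW.
    (* [cvg_harmonic] is about [1 / (n + 1)], hence the shift of index. *)
    have inv0 : (fun d => d%:R^-1) @ \oo --> (0 : R).
      by rewrite -cvg_shiftS; exact: cvg_harmonic.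
    rewrite (_ : 0 = e ^- 2 * (C * 0 + C * 0)); last by ring.
    by apply: cvgMr; apply: cvgD; apply: cvgMr.
  apply: (@squeeze_cvge _ _ _ _ (fun=> 0%E) _
    (fun d => (e ^- 2 * (C * d%:R^-1 + C * (s d / d%:R ^+ 2)))%:E)) => //; last exact: cvg_cst.
  near=> d; rewrite measure_ge0 /=.
  have d0 : (0 : R) < d%:R by rewrite ltr0n; near: d; exact: nbhs_infty_gt.
  have -> : [set w | e <= `|(S d w - m d) / d%:R - 0|] = [set w | e * d%:R <= `|S d w - m d|].
    apply/seteqP; split => w /=; rewrite subr0 normrM normfV (gtr0_norm d0) ler_pdivlMr //.
  apply: (le_trans (SP d _ (mulr_gt0 e0 d0))); rewrite lee_fin le_eqVlt; apply/orP; left; apply/eqP.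
  by field; rewrite !gt_eqF.
move=> h.
rewrite (_ : (fun p => _) = (fun p : {d : nat & Om d} =>
  (S (tag p) (tagged p) - m (tag p)) / (tag p)%:R + m (tag p) / (tag p)%:R)); last first.
  by apply/funext => p; rewrite -mulrDl subrK.
by rewrite -[c]add0r; exact: cvgD h (whp_cvg_det _ _ mc).
Unshelve. all: by end_near. Qed.

End HighProbability.

(** * Limits along a filter: strict comparison, finite sums, averages over pairs *)

Section Filters.
Context {R : realType} {T : Type} {F : set_system T} {FF : Filter F}.

(** The midpoint of [a] and [b] eventually separates the two functions. *)
Lemma cvg_lt_near (f g : T -> R) (a b : R) :
  f x @[x --> F] --> a -> g x @[x --> F] --> b -> a < b ->
  \forall x \near F, f x < g x.
Proof.
move=> fa gb ab.
have am : a < (a + b) / 2 by lra.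
have mb : (a + b) / 2 < b by lra.
have hf := @cvgr_lt _ _ _ FF f a fa _ am.
have hg := @cvgr_gt _ _ _ FF g b gb _ mb.
by apply: filterS2 hf hg => x; exact: lt_trans.
Qed.

Lemma cvg_sum_seq (I : Type) (s : seq I) (Q : pred I) (f : I -> T -> R) (a : I -> R) :
  (forall i, Q i -> f i x @[x --> F] --> a i) ->
  \sum_(i <- s | Q i) f i x @[x --> F] --> \sum_(i <- s | Q i) a i.
Proof.
move=> fa; elim: s => [|i s IH].
  by rewrite big_nil; under eq_fun do rewrite big_nil; exact: cvg_cst.
rewrite big_cons; under eq_fun do rewrite big_cons.
by case: ifP => // Qi; apply: cvgD => //; exact: fa.
Qed.

Lemma sum_ltn_pairs (n : nat) (c : R) :
  \sum_(s < n) \sum_(t < n | (s < t)%N) c = 'C(n, 2)%:R * c.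
Proof.
(* With [t] outermost the inner sum has [t] equal terms, and the sum of all [t < n] is
   ['C(n, 2)]. *)
rewrite (exchange_big_dep predT) //=.
under eq_bigr => t _.
  rewrite -(big_ord_widen n (fun=> c) (ltnW (ltn_ord t))) sumr_const card_ord -mulr_natl.
  over.
by rewrite -mulr_suml -natr_sum -bin2_sum big_mkord.
Qed.

Lemma cvg_pair_average (n : nat) (h : 'I_n -> 'I_n -> T -> R) (c : R) : (2 <= n)%N ->
  (forall s t, s != t -> h s t x @[x --> F] --> c) ->
  'C(n, 2)%:R^-1 * \sum_(s < n) \sum_(t < n | (s < t)%N) h s t x @[x --> F] --> c.
Proof.
move=> n2 hc.
(* Once the limit is written as its own pair average, convergence is termwise; [2 <= n] keeps the
   binomial coefficient nonzero. *)
have -> : c = 'C(n, 2)%:R^-1 * \sum_(s < n) \sum_(t < n | (s < t)%N) c.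
  by rewrite sum_ltn_pairs mulKf // pnatr_eq0 -lt0n bin_gt0.
apply: cvgMr; apply: cvg_sum_seq => s _; apply: cvg_sum_seq => t st.
by apply: hc; rewrite -(inj_eq val_inj) ltn_eqF.
Qed.

End Filters.

(** The minimum of an empty family is [0] by convention, hence the two positivity hypotheses. *)
Lemma fmin_lt {R : realType} (n m : nat) (f : 'I_n -> R) (g : 'I_m -> R) :
  (0 < n)%N -> (0 < m)%N -> (forall i l, f i < g l) -> fmin f < fmin g.
Proof.
case: n f => // n f; case: m g => // m g _ _ fg /=.
apply: (le_lt_trans (bigmin_le_id _ _ _ _)).
by apply/bigmin_gtP; split.
Qed.

(** * Measurability of the classification events *)

Section MeasurableEvents.
Context {R : realType} {dsp : measure_display} {T : measurableType dsp}.

Lemma measurable_const_prop (c : Prop) : measurable [set _ : T | c].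
Proof. by have [/propT ->|/propF ->] := pselect c; [exact: measurableT|exact: measurable0]. Qed.

Lemma measurable_imply (Q S : T -> Prop) : measurable [set w | Q w] ->
  measurable [set w | S w] -> measurable [set w | Q w -> S w].
Proof.
move=> mQ mS; rewrite (_ : [set w | Q w -> S w] = ~` [set w | Q w] `|` [set w | S w]).
  by apply: measurableU => //; exact: measurableC.
apply/seteqP; split => w /=; last by move=> [nq /nq|].
by move=> h; have [/h|] := pselect (Q w); [right|left].
Qed.

Lemma measurable_forall (K : finType) (Q : K -> T -> Prop) :
  (forall i, measurable [set w | Q i w]) -> measurable [set w | forall i, Q i w].
Proof.
move=> mQ; rewrite (_ : [set w | _] = \bigcap_(i in [set: K]) [set w | Q i w]).
  by apply: fin_bigcap_measurable => // i _; exact: mQ.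
by apply/seteqP; split => w /= h i; [move=> _; exact: h|exact: h].
Qed.

Lemma measurable_le_set (f g : T -> R) : measurable_fun setT f ->
  measurable_fun setT g -> measurable [set w | f w <= g w].
Proof.
by move=> mf mg; rewrite -[X in measurable X]setTI; exact: measurable_fun_ler.
Qed.

Lemma measurable_lt_set (f g : T -> R) : measurable_fun setT f ->
  measurable_fun setT g -> measurable [set w | f w < g w].
Proof.
by move=> mf mg; rewrite -[X in measurable X]setTI; exact: measurable_fun_ltr.
Qed.

Lemma measurable_sum_cond (I : Type) (s : seq I) (Q : pred I) (f : I -> T -> R) :
  (forall i, measurable_fun setT (f i)) ->
  measurable_fun setT (fun w => \sum_(i <- s | Q i) f i w).
Proof. by move=> mf; under eq_fun do rewrite -big_filter; exact: measurable_sum. Qed.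

Lemma measurable_fmin (n : nat) (f : 'I_n -> T -> R) :
  (forall i, measurable_fun setT (f i)) ->
  measurable_fun setT (fun w => fmin (fun i => f i w)).
Proof.
case: n f => [|n] f mf /=; first exact: measurable_cst.
elim: (index_enum _) => [|i s IH].
  by under eq_fun do rewrite big_nil; exact: mf.
by under eq_fun do rewrite big_cons; exact: measurable_minr.
Qed.

Context {J : nat} {n : 'I_J -> nat} {d : nat}.
Variables (z : T -> 'I_d -> R) (x : forall j : 'I_J, 'I_(n j) -> T -> 'I_d -> R).
Hypothesis mz : forall r, measurable_fun setT (fun w => z w r).
Hypothesis mx : forall j i r, measurable_fun setT (fun w => x j i w r).
Local Notation xs w := (fun (j : 'I_J) (i : 'I_(n j)) => x j i w).

Lemma measurable_enormB (y y' : T -> 'I_d -> R) :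
  (forall r, measurable_fun setT (fun w => y w r)) ->
  (forall r, measurable_fun setT (fun w => y' w r)) ->
  measurable_fun setT (fun w => enorm (fun r => y w r - y' w r)).
Proof.
move=> my my'; apply: (measurableT_comp (continuous_measurable_fun (@sqrt_continuous R))).
exact: measurable_sqd_vec.
Qed.

Lemma measurable_knn_set (k : nat) (N : {set tidx n}) :
  measurable [set w | knn_set (z w) (xs w) k N].
Proof.
apply: (measurableI [set _ | #|N| = k] [set w | forall s t, s \in N -> t \notin N ->
  tdist (z w) (xs w) s <= tdist (z w) (xs w) t]).
  exact: measurable_const_prop.
pose K : finType := tidx n.
apply: (measurable_forall K) => s; apply: (measurable_forall K) => t.
do 2 (apply: measurable_imply; first exact: measurable_const_prop).
by apply: measurable_le_set; apply: measurable_enormB => // r; exact: mx.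
Qed.

Lemma measurable_knn_surely (k : nat) (j : 'I_J) :
  measurable [set w | knn_surely (z w) (xs w) k j].
Proof.
apply: measurable_forall => N; apply: measurable_imply; first exact: measurable_knn_set.
exact: measurable_const_prop.
Qed.

Lemma measurable_knn_possibly (k : nat) (j : 'I_J) :
  measurable [set w | knn_possibly (z w) (xs w) k j].
Proof.
(* The existential over neighbor sets becomes the complement of a finite universal, which
   [measurable_forall] handles. *)
rewrite (_ : [set w | _] = ~` [set w | forall N : {set tidx n},
    knn_set (z w) (xs w) k N -> ~ forall j', (votes N j' <= votes N j)%N]).
  apply: measurableC; apply: measurable_forall => N.
  apply: measurable_imply; first exact: measurable_knn_set.
  exact: measurable_const_prop.
apply/seteqP; split => w /=; first by move=> [N [kN vN]] /(_ N kN).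
move=> h; apply: contrapT => np; apply: h => N kN vN.
by apply: np; exists N.
Qed.

Lemma measurable_avg_pair (j : 'I_J) (g : R -> R) : measurable_fun setT g ->
  measurable_fun setT (fun w => avg_pair (xs w) j g).
Proof.
move=> mg; apply: measurable_funM => //; apply: measurable_sum => s.
apply: measurable_sum_cond => t.
by apply: measurableT_comp => //; apply: measurable_enormB => r; exact: mx.
Qed.

Lemma measurable_CH_assign (j : 'I_J) : measurable [set w | CH_assign (z w) (xs w) j].
Proof.
have mr i : measurable_fun setT (fun w => fmin (@rho _ _ _ _ (z w) (xs w) i)).
  apply: measurable_fmin => l; apply: measurable_funB.
    by apply: measurable_funX; apply: measurable_enormB => // r; exact: mx.
  by apply: measurable_funM => //; apply: measurable_avg_pair; exact: exprn_measurable.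
apply: measurable_forall => i; apply: measurable_imply; first exact: measurable_const_prop.
exact: measurable_lt_set.
Qed.

Lemma measurable_MCH_assign (j : 'I_J) : measurable [set w | MCH_assign (z w) (xs w) j].
Proof.
have mr i : measurable_fun setT (fun w => fmin (@rho_star _ _ _ _ (z w) (xs w) i)).
  apply: measurable_fmin => l; apply: measurable_funB.
    by apply: measurable_enormB => // r; exact: mx.
  by apply: measurable_funM => //; exact: measurable_avg_pair.
apply: measurable_forall => i; apply: measurable_imply; first exact: measurable_const_prop.
exact: measurable_lt_set.
Qed.

End MeasurableEvents.

(** * Vote counts of the nearest neighbor rule *)

Section NearestNeighbors.
Context {R : realType} {J : nat} {n : 'I_J -> nat} {d : nat}.
Variables (z : 'I_d -> R) (x : forall j : 'I_J, 'I_(n j) -> 'I_d -> R).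

(** A single neighbor from class [j] would force every training point of [j0], all being strictly
    closer, into [N], which has only [k < n j0] elements. *)
Lemma knn_votes_far (k : nat) (N : {set tidx n}) (j0 j : 'I_J) :
  (k < n j0)%N -> knn_set z x k N ->
  (forall i l, tdist z x (Tagged (fun j => 'I_(n j)) (i : 'I_(n j0))) <
               tdist z x (Tagged (fun j => 'I_(n j)) (l : 'I_(n j)))) ->
  votes N j = 0%N.
Proof.
move=> kn [Nk near] far; apply/eqP; rewrite cards_eq0; apply/eqP/setP => -[j' l].
rewrite !inE /=; apply/negP => /andP[lN /eqP j'j]; subst j'.
have sub : imset (@Tagged _ j0 (fun j => 'I_(n j))) (mem 'I_(n j0)) \subset N.
  apply/fintype.subsetP => _ /imsetP[i _ ->]; apply: contraT => iN.
  by have := near _ _ lN iN; rewrite leNgt far.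
have := subset_leq_card sub.
rewrite card_imset; last by move=> a b ab; exact: eq_from_Tagged ab.
by rewrite card_ord Nk leqNgt kn.
Qed.

(** Excludes a tie of all classes at zero votes: [knn_votes_far] rules classes out, and this ensures
    that one remains. *)
Lemma knn_votes_gt0 (k : nat) (N : {set tidx n}) : (0 < k)%N -> knn_set z x k N ->
  exists j, (0 < votes N j)%N.
Proof.
move=> k0 [Nk _]; have : (0 < #|N|)%N by rewrite Nk.
move=> /card_gt0P[s sN]; exists (tag s).
by apply/card_gt0P; exists s; rewrite inE sN /=.
Qed.

End NearestNeighbors.

(** * Asymptotics of the classifiers *)

Section Classification.
Context {R : realType} {J : nat} {n : 'I_J -> nat} {dsp : nat -> measure_display}
  {Om : forall d : nat, measurableType (dsp d)}.
Variable P : forall d : nat, probability (Om d) R.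
Variable X : forall (d : nat) (j : 'I_J), 'I_(n j) -> Om d -> ('I_d -> R).
Variable Z : forall (d : nat) (j : 'I_J), Om d -> ('I_d -> R).
Variables (sigma2 : 'I_J -> R) (nu2 : 'I_J -> 'I_J -> R) (M : R).
Hypothesis n_ge2 : forall j, (2 <= n j)%N.
Hypothesis mX : forall d j i r, measurable_fun setT (fun w => X d j i w r).
Hypothesis mZ : forall d j r, measurable_fun setT (fun w => Z d j w r).
Hypothesis lawX : forall d j i, same_law (P d) (X d j i) (Z d j).
Hypothesis indep : forall d j, mutually_indep (P d)
  (fun o : option (tidx n) => match o with
                              | None => Z d j
                              | Some s => X d (tag s) (tagged s) end).
Hypothesis Z4 : forall d j r, (\int[P d]_w ((Z d j w r) ^+ 4)%:E <= M%:E)%E.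
Hypothesis corr0 : forall j i l, (fun d : nat =>
  (\sum_(r < d) \sum_(s < d | s != r)
     `| Corr (P d) (fun w => (Z d j w r - X d i l w r) ^+ 2)
                   (fun w => (Z d j w s - X d i l w s) ^+ 2) |)
  / (d%:R ^+ 2)) @ \oo --> (0 : R).
Hypothesis trace_cvg : forall j, (fun d : nat =>
  (\sum_(r < d) Var (P d) (fun w => Z d j w r)) / d%:R) @ \oo --> sigma2 j.
Hypothesis mean_cvg : forall j i, i != j -> (fun d : nat =>
  (\sum_(r < d) (Ex (P d) (fun w => Z d j w r) - Ex (P d) (fun w => Z d i w r)) ^+ 2)
    / d%:R) @ \oo --> nu2 j i.

Local Notation Om_ := {d : nat & Om d}.
Local Notation F := (whp P).
Local Notation "'z_ j" := (fun p : Om_ => Z (tag p) j (tagged p)) (at level 8, j at level 2).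
Local Notation x_ p := (fun (j : 'I_J) (i : 'I_(n j)) => X (tag p) j i (tagged p)).

(* [nu2 j j] is unconstrained by the hypotheses. *)
Definition sep (j i : 'I_J) : R := if i == j then 0 else nu2 j i.
(** Limit in probability of the squared distance, divided by [d], between independent observations
    of classes [j] and [i]; [dlim j j] is [2 * sigma2 j]. *)
Definition dlim (j i : 'I_J) : R := sigma2 j + sigma2 i + sep j i.

Lemma indep_ZX d j i l : indep_pair (P d) d (Z d j) (X d i l).
Proof.
exact: (mutually_indep_pair _ _ _ _ None (Some (Tagged (fun j => 'I_(n j)) l)) (indep d j)).
Qed.

Lemma indep_XX d j s t : s != t -> indep_pair (P d) d (X d j s) (X d j t).
Proof.
move=> st.
apply: (mutually_indep_pair _ _ _ _ (Some (Tagged (fun j => 'I_(n j)) s))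
  (Some (Tagged (fun j => 'I_(n j)) t)) (indep d j)).
by apply: contra_neq st => h; apply: eq_from_Tagged (Some_inj h).
Qed.

(** Mean of the squared distance between independent observations of the two classes. *)
Definition dmean (d : nat) (j i : 'I_J) : R :=
  \sum_r Var (P d) (fun w => Z d j w r) + \sum_r Var (P d) (fun w => Z d i w r) +
  \sum_r (Ex (P d) (fun w => Z d j w r) - Ex (P d) (fun w => Z d i w r)) ^+ 2.

Lemma dmean_cvg j i : (fun d => dmean d j i / d%:R) @ \oo --> dlim j i.
Proof.
rewrite /dmean; under eq_fun do rewrite !mulrDl.
apply: cvgD; first by apply: cvgD; exact: trace_cvg.
(* Within one class the mean differences vanish identically; (A3) supplies the limit for distinct
   classes. *)
rewrite /sep; case: eqVneq => [->|ij]; last exact: mean_cvg.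
rewrite (_ : (fun d => _) = cst 0); first exact: cvg_cst.
by apply/funext => d; rewrite big1 ?mul0r // => r _; rewrite subrr expr0n.
Qed.

Lemma deviation_ZX d j i l (e : R) : 0 < e ->
  (P d [set w | (e <= `|sqd (Z d j w) (X d i l w) - dmean d j i|)%R] <=
   (e ^- 2 * (16 * M * d%:R + 16 * M * \sum_r \sum_(s | s != r)
      `|Corr (P d) (fun w => (Z d j w r - X d i l w r) ^+ 2)
                   (fun w => (Z d j w s - X d i l w s) ^+ 2)|))%:E)%E.
Proof.
move=> e0; apply: sqd_deviation => //.
exact: indep_ZX.
Qed.

Lemma dist_test_cvg j i l :
  (fun p : Om_ => sqd ('z_ j p) (x_ p i l) / (tag p)%:R) @ F --> dlim j i.
Proof.
apply: (whp_cvg_average P (fun d w => sqd (Z d j w) (X d i l w)) (fun d => dmean d j i)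
  _ (16 * M) _ _ _ (corr0 j i l) (dmean_cvg j i)).
- by move=> d; exact: measurable_sqd_vec.
- by move=> d e e0; exact: deviation_ZX.
Qed.

(* (X_js, X_jt) has the law of (Z_j, X_jt), to which the correlation bound applies. *)
Lemma dist_train_cvg j s t : s != t ->
  (fun p : Om_ => sqd (x_ p j s) (x_ p j t) / (tag p)%:R) @ F --> dlim j j.
Proof.
move=> st.
apply: (whp_cvg_average P (fun d w => sqd (X d j s w) (X d j t w)) (fun d => dmean d j j)
  _ (16 * M) _ _ _ (corr0 j j t) (dmean_cvg j j)).
- by move=> d; exact: measurable_sqd_vec.
- move=> d e e0; pose S := [set y : R | e <= `|y - dmean d j j|].
  have mS : measurable S.
    by apply: measurable_le_set => //; apply: measurableT_comp => //; exact: measurable_funB.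
  rewrite -/(S) (_ : [set w | _] = [set w | S (sqd (X d j s w) (X d j t w))]) //.
  rewrite (sqd_law (P d) d (X d j s) (X d j t) (Z d j) (X d j t)) //; last first.
    exact: indep_ZX.
    exact: indep_XX.
  exact: deviation_ZX.
Qed.

Lemma sigma2_ge0 j : 0 <= sigma2 j.
Proof.
apply: (cvgr_to_ge (trace_cvg j)); apply: nearW => d.
rewrite divr_ge0 ?ler0n // sumr_ge0 // => r _; apply: Var_ge0.
by apply: (@L4_L2 _ _ _ _ M); split.
Qed.

Lemma sep_ge0 j i : 0 <= sep j i.
Proof.
rewrite /sep; case: eqVneq => // ij.
apply: (cvgr_to_ge (mean_cvg j i ij)); apply: nearW => d.
by rewrite divr_ge0 ?ler0n // sumr_ge0 // => r _; rewrite sqr_ge0.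
Qed.

(** Both are limits of the same sequence, squared differences being symmetric. This lets part (a)
    exchange the roles of two classes. *)
Lemma nu2C j i : i != j -> nu2 i j = nu2 j i.
Proof.
move=> ij; apply: (@norm_cvg_unique _ _ _ _ _ _ _ (mean_cvg j i ij)).
have ji : j != i by rewrite eq_sym.
move: (mean_cvg i j ji); rewrite (_ : (fun d : nat =>
    (\sum_(r < d) (Ex (P d) (fun w => Z d i w r) - Ex (P d) (fun w => Z d j w r)) ^+ 2) / d%:R) =
  (fun d : nat =>
    (\sum_(r < d) (Ex (P d) (fun w => Z d j w r) - Ex (P d) (fun w => Z d i w r)) ^+ 2) / d%:R)) //.
apply/funext => d; congr (_ / _); apply: eq_bigr => r _.
by rewrite -sqrrN opprB.
Qed.

Lemma tdist_lt j a b : dlim j a < dlim j b ->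
  \forall p \near F, forall (i : 'I_(n a)) (l : 'I_(n b)),
    tdist ('z_ j p) (x_ p) (Tagged (fun j => 'I_(n j)) i) <
    tdist ('z_ j p) (x_ p) (Tagged (fun j => 'I_(n j)) l).
Proof.
move=> ab; apply: filter_forall => i; apply: filter_forall => l.
have near := cvg_lt_near (FF := whp_filter P) _ _ _ _ (dist_test_cvg j a i) (dist_test_cvg j b l) ab.
apply: (whpS P _ _ _ near) => -[d w] /= dlt.
(* Dimension [0] is excluded by the strict inequality itself: there the inverse is [0] and both
   sides would vanish. *)
have d0 : (0 : R) < d%:R^-1.
  by rewrite lt_neqAle invr_ge0 ler0n andbT; apply: contraTneq dlt => <-; rewrite !mulr0 ltxx.
rewrite ltr_pM2r // in dlt; rewrite /tdist /enorm /= ltr_sqrt //.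
by apply: le_lt_trans dlt; apply: sumr_ge0 => r _; exact: sqr_ge0.
Qed.

(** With high probability every training point of class [j] is closer than all those of other
    classes, so a set of [k < n j] nearest neighbors lies inside class [j]. *)
Lemma knn_consistent k : (1 <= k)%N -> (forall j, (k < n j)%N) ->
  (forall j i, j != i -> `|sigma2 j - sigma2 i| < nu2 j i) ->
  forall j, (fun d => P d [set w | ~ knn_surely (Z d j w) (fun j0 i0 => X d j0 i0 w) k j])
    @ \oo --> 0%E.
Proof.
move=> k1 kn sn j; apply: (whp_prob0 P) => [d|].
  by apply: measurableC; exact: measurable_knn_surely.
have far : \forall p \near F, forall b, j != b ->
    forall (i : 'I_(n j)) (l : 'I_(n b)),
    tdist ('z_ j p) (x_ p) (Tagged (fun j => 'I_(n j)) i) <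
    tdist ('z_ j p) (x_ p) (Tagged (fun j => 'I_(n j)) l).
  apply: filter_forall => b; have [<-|jb] := eqVneq j b; first exact: nearW.
  (* This amounts to [sigma2 j - sigma2 b < nu2 j b], one half of the bound on the absolute
     value. *)
  have : dlim j j < dlim j b.
    have := sn j b jb; rewrite /dlim /sep eqxx eq_sym (negbTE jb) ltr_norml => /andP[_].
    lra.
  by move=> /tdist_lt near; apply: (whpS P _ _ _ near) => p h _.
apply: (whpS P _ _ _ far) => -[d w] /= {}far; apply: contrapT => /contrapT; apply => N kN.
have v0 b : b != j -> votes N b = 0%N.
  by move=> bj; apply: (knn_votes_far _ _ _ _ j b (kn j) kN); apply: far; rewrite eq_sym.
move=> b bj; rewrite v0 //.
(* Some class gets a vote, and it can only be [j]. *)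
have [a va] := knn_votes_gt0 _ _ _ _ k1 kN.
by have [<-//|/v0 a0] := eqVneq a j; rewrite a0 in va.
Qed.

(** The class that is lost is the one with the larger [sigma2]: its test points are closer to every
    training point of the other class than to any of their own, so their own class gets no vote. *)
Lemma knn_inconsistent k : (1 <= k)%N -> (forall j, (k < n j)%N) ->
  (exists j i, j != i /\ nu2 j i < `|sigma2 j - sigma2 i|) ->
  exists j, (fun d => P d [set w | ~ knn_possibly (Z d j w) (fun j0 i0 => X d j0 i0 w) k j])
    @ \oo --> 1%E.
Proof.
move=> k1 kn.
have main j i : j != i -> nu2 j i < sigma2 j - sigma2 i ->
    (fun d => P d [set w | ~ knn_possibly (Z d j w) (fun j0 i0 => X d j0 i0 w) k j])
    @ \oo --> 1%E.
  move=> ji ns.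
  have ij : dlim j i < dlim j j.
    by rewrite /dlim /sep eqxx eq_sym (negbTE ji); lra.
  have mE d : measurable [set w | knn_possibly (Z d j w) (fun j0 i0 => X d j0 i0 w) k j].
    exact: measurable_knn_possibly.
  have E0 := whp_prob0 P (fun d => [set w | knn_possibly (Z d j w)
    (fun j0 i0 => X d j0 i0 w) k j]) mE.
  rewrite (_ : (fun d => _) = (fun d => 1 - P d [set w | knn_possibly (Z d j w)
      (fun j0 i0 => X d j0 i0 w) k j])%E); last first.
    by apply/funext => d; rewrite -probability_setC.
  rewrite -[X in _ --> X]sube0; apply: cvgeB => //; first exact: cvg_cst.
  apply: E0; have near := tdist_lt j i j ij; apply: (whpS P _ _ _ near) => -[d w] /= {}near [N [kN vN]].
  have v0 : votes N j = 0%N by exact: (knn_votes_far _ _ _ _ i j (kn i) kN).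
  (* A class without votes cannot attain the maximum, since some class has a positive count. *)
  have [a] := knn_votes_gt0 _ _ _ _ k1 kN.
  by rewrite ltnNge (leq_trans (vN a)) // v0.
(* The branch of the absolute value decides which of the two classes is misclassified. *)
move=> [j [i [ji]]]; rewrite ltr_normr => /orP[h|h].
  by exists j; exact: (main j i).
exists i; apply: (main i j); first by rewrite eq_sym.
by rewrite nu2C 1?eq_sym //; lra.
Qed.

Lemma CH_consistent : (forall j i, j != i -> 0 < nu2 j i) ->
  forall j, (fun d => P d [set w | ~ CH_assign (Z d j w) (fun j0 i0 => X d j0 i0 w) j])
    @ \oo --> 0%E.
Proof.
move=> nu0 j; apply: (whp_prob0 P) => [d|].
  by apply: measurableC; exact: measurable_CH_assign.
(* Subtracting half of [dlim a a = 2 * sigma2 a] removes the scale of class [a]; what remains is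
   [sigma2 j], common to all [a], and the location term [sep j a]. *)
have rho_cvg a (i : 'I_(n a)) :
    (fun p : Om_ => rho ('z_ j p) (x_ p) i / (tag p)%:R) @ F --> sigma2 j + sep j a.
  have -> : sigma2 j + sep j a = dlim j a - 2^-1 * dlim a a.
    by rewrite /dlim {3}/sep eqxx; field.
  rewrite (_ : (fun p => _) = (fun p : Om_ => sqd ('z_ j p) (x_ p a i) / (tag p)%:R -
      2^-1 * ('C(n a, 2)%:R^-1 * \sum_(s < n a) \sum_(t < n a | (s < t)%N)
        (sqd (x_ p a s) (x_ p a t) / (tag p)%:R)))); last first.
    have sqE (d : nat) (y y' : 'I_d -> R) : enorm (fun r => y r - y' r) ^+ 2 = sqd y y'.
      by rewrite sqr_sqrtr // sumr_ge0 // => r _; rewrite sqr_ge0.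
    apply/funext => p; rewrite /rho /avg_pair sqE mulrBl; congr (_ - _).
    rewrite -!mulrA mulr_suml; do 2 congr (_ * _); apply: eq_bigr => s _.
    by rewrite mulr_suml; apply: eq_bigr => t _; rewrite sqE.
  apply: cvgB; first exact: dist_test_cvg.
  apply: cvgMr; apply: (cvg_pair_average _ (fun s t (p : Om_) =>
    sqd (x_ p a s) (x_ p a t) / (tag p)%:R)) => // s t st.
  exact: dist_train_cvg.
have lt : \forall p \near F, forall b, b != j -> forall (i : 'I_(n j)) (l : 'I_(n b)),
    rho ('z_ j p) (x_ p) i / (tag p)%:R < rho ('z_ j p) (x_ p) l / (tag p)%:R.
  apply: filter_forall => b; have [->|bj] := eqVneq b j; first exact: nearW.
  have : \forall p \near F, forall (i : 'I_(n j)) (l : 'I_(n b)),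
      rho ('z_ j p) (x_ p) i / (tag p)%:R < rho ('z_ j p) (x_ p) l / (tag p)%:R.
    apply: filter_forall => i; apply: filter_forall => l.
    apply: (cvg_lt_near (FF := whp_filter P) _ _ _ _ (rho_cvg j i) (rho_cvg b l)).
    by rewrite /sep eqxx (negbTE bj) addr0 ltrDl nu0 // eq_sym.
  by move=> near; apply: (whpS P _ _ _ near) => p h _.
apply: (whpS P _ _ _ lt) => -[d w] /= {}lt; apply: contrapT => /contrapT; apply => b bj.
apply: fmin_lt; [exact: ltnW (n_ge2 _)|exact: ltnW (n_ge2 _)|move=> i l].
have dlt := lt b bj i l.
have d0 : (0 : R) < d%:R^-1.
  by rewrite lt_neqAle invr_ge0 ler0n andbT; apply: contraTneq dlt => <-; rewrite !mulr0 ltxx.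
by rewrite ltr_pM2r // in dlt.
Qed.

Lemma MCH_consistent : (forall j i, j != i -> 0 < nu2 j i \/ sigma2 j != sigma2 i) ->
  forall j, (fun d => P d [set w | ~ MCH_assign (Z d j w) (fun j0 i0 => X d j0 i0 w) j])
    @ \oo --> 0%E.
Proof.
move=> ns j; apply: (whp_prob0 P) => [d|].
  by apply: measurableC; exact: measurable_MCH_assign.
(* Distances scale like the root of [d], and continuity of the root carries over the limits of the
   squared distances. *)
have rho_cvg a (i : 'I_(n a)) :
    (fun p : Om_ => rho_star ('z_ j p) (x_ p) i / Num.sqrt (tag p)%:R) @ F -->
    Num.sqrt (dlim j a) - 2^-1 * Num.sqrt (dlim a a).
  have sqrt_cvg (f : Om_ -> R) c : f @ F --> c -> (fun p => Num.sqrt (f p)) @ F --> Num.sqrt c.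
    by move=> fc; exact: (continuous_cvg _ (@sqrt_continuous R c) fc).
  rewrite (_ : (fun p => _) = (fun p : Om_ => Num.sqrt (sqd ('z_ j p) (x_ p a i) / (tag p)%:R) -
      2^-1 * ('C(n a, 2)%:R^-1 * \sum_(s < n a) \sum_(t < n a | (s < t)%N)
        Num.sqrt (sqd (x_ p a s) (x_ p a t) / (tag p)%:R)))); last first.
    have sqE (d : nat) (y y' : 'I_d -> R) :
        enorm (fun r => y r - y' r) / Num.sqrt d%:R = Num.sqrt (sqd y y' / d%:R).
      rewrite sqrtrM ?sqrtrV ?ler0n // sumr_ge0 // => r _; exact: sqr_ge0.
    apply/funext => p; rewrite /rho_star /avg_pair mulrBl sqE; congr (_ - _).
    rewrite -!mulrA mulr_suml; do 2 congr (_ * _); apply: eq_bigr => s _.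
    by rewrite mulr_suml; apply: eq_bigr => t _; rewrite sqE.
  apply: cvgB; first exact/sqrt_cvg/dist_test_cvg.
  apply: cvgMr; apply: (cvg_pair_average _ (fun s t (p : Om_) =>
    Num.sqrt (sqd (x_ p a s) (x_ p a t) / (tag p)%:R))) => // s t st.
  exact/sqrt_cvg/dist_train_cvg.
(* With [u] and [v] the roots of [2 * sigma2 j] and [2 * sigma2 b], the claim is that [(u + v) / 2]
   lies below the root of [(u^2 + v^2) / 2 + nu2 j b]. *)
have lim_lt b : b != j -> Num.sqrt (dlim j j) - 2^-1 * Num.sqrt (dlim j j) <
    Num.sqrt (dlim j b) - 2^-1 * Num.sqrt (dlim b b).
  move=> bj; have sj := sigma2_ge0 j; have sb := sigma2_ge0 b.
  have nb : 0 <= nu2 j b by have := sep_ge0 j b; rewrite /sep (negbTE bj).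
  have jb : 0 < nu2 j b \/ sigma2 j != sigma2 b by apply: ns; rewrite eq_sym.
  have -> : dlim j j = 2 * sigma2 j by rewrite /dlim /sep eqxx; ring.
  have -> : dlim b b = 2 * sigma2 b by rewrite /dlim /sep eqxx; ring.
  have -> : dlim j b = sigma2 j + sigma2 b + nu2 j b by rewrite /dlim /sep (negbTE bj).
  have u0 : 0 <= Num.sqrt (2 * sigma2 j) by exact: sqrtr_ge0.
  have v0 : 0 <= Num.sqrt (2 * sigma2 b) by exact: sqrtr_ge0.
  have u2 : Num.sqrt (2 * sigma2 j) ^+ 2 = 2 * sigma2 j by rewrite sqr_sqrtr // mulr_ge0.
  have v2 : Num.sqrt (2 * sigma2 b) ^+ 2 = 2 * sigma2 b by rewrite sqr_sqrtr // mulr_ge0.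
  move: u0 v0 u2 v2; set u := Num.sqrt _; set v := Num.sqrt (2 * _) => u0 v0 u2 v2.
  suff : (u + v) / 2 < Num.sqrt (sigma2 j + sigma2 b + nu2 j b) by lra.
  rewrite -[X in X < _]ger0_norm; last by lra.
  rewrite -sqrtr_sqr ltr_sqrt.
    (* The gap between the two squares is [(u - v)^2 / 4 + nu2 j b], positive through [nu2] or
       because distinct variances give distinct [u] and [v]. *)
    have -> : ((u + v) / 2) ^+ 2 = (u ^+ 2 + v ^+ 2) / 2 - (u - v) ^+ 2 / 4 by field.
    have uv2 := sqr_ge0 (u - v); rewrite u2 v2.
    case: jb => [h|h]; first by lra.
    have uv : 0 < (u - v) ^+ 2.
      rewrite lt_neqAle sqr_ge0 andbT eq_sym sqrf_eq0 subr_eq0.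
      apply: contra h => /eqP uv; have two : (2 : R) != 0 by [].
      by apply/eqP/(mulfI two); rewrite -u2 uv.
    by lra.
  (* [ltr_sqrt] also asks for a positive radicand; in the second case two distinct nonnegative
     variances are not both zero. *)
  case: jb => [h|h]; first by lra.
  by move/eqP : h => h; lra.
have lt : \forall p \near F, forall b, b != j -> forall (i : 'I_(n j)) (l : 'I_(n b)),
    rho_star ('z_ j p) (x_ p) i / Num.sqrt (tag p)%:R <
    rho_star ('z_ j p) (x_ p) l / Num.sqrt (tag p)%:R.
  apply: filter_forall => b; have [->|bj] := eqVneq b j; first exact: nearW.
  have : \forall p \near F, forall (i : 'I_(n j)) (l : 'I_(n b)),
      rho_star ('z_ j p) (x_ p) i / Num.sqrt (tag p)%:R <
      rho_star ('z_ j p) (x_ p) l / Num.sqrt (tag p)%:R.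
    apply: filter_forall => i; apply: filter_forall => l.
    exact: (cvg_lt_near (FF := whp_filter P) _ _ _ _ (rho_cvg j i) (rho_cvg b l) (lim_lt b bj)).
  by move=> near; apply: (whpS P _ _ _ near) => p h _.
apply: (whpS P _ _ _ lt) => -[d w] /= {}lt; apply: contrapT => /contrapT; apply => b bj.
apply: fmin_lt; [exact: ltnW (n_ge2 _)|exact: ltnW (n_ge2 _)|move=> i l].
have dlt := lt b bj i l.
(* In dimension [0] the inverse root is [0], and the strict inequality would read [0 < 0]. *)
have d0 : (0 : R) < (Num.sqrt d%:R)^-1.
  rewrite lt_neqAle invr_ge0 sqrtr_ge0 andbT.
  by apply: contraTneq dlt => <-; rewrite !mulr0 ltxx.
by rewrite ltr_pM2r // in dlt.
Qed.

End Classification.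

Theorem theorem1
  (R : realType) (J : nat) (n : 'I_J -> nat) (k : nat)
  (dsp : nat -> measure_display) (Om : forall d : nat, measurableType (dsp d))
  (P : forall d : nat, probability (Om d) R)
  (* training sample X d j i (i-th observation of class j in dimension d) *)
  (X : forall (d : nat) (j : 'I_J), 'I_(n j) -> Om d -> ('I_d -> R))
  (* test observation Z d j drawn from class j (law F_j) *)
  (Z : forall (d : nat) (j : 'I_J), Om d -> ('I_d -> R))
  (sigma2 : 'I_J -> R) (nu2 : 'I_J -> 'I_J -> R) :
  (2 <= J)%N ->
  (forall j, 2 <= n j)%N ->
  (forall d j i r, measurable_fun setT (fun w => X d j i w r)) ->
  (forall d j r, measurable_fun setT (fun w => Z d j w r)) ->
  (* X d j i ~ F_j, where F_j is the law of Z d j *)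
  (forall d j i, same_law (P d) (X d j i) (Z d j)) ->
  (* training observations mutually independent, test observation independent of them *)
  (forall d j, mutually_indep (P d)
      (fun o : option (tidx n) => match o with
                                  | None => Z d j
                                  | Some s => X d (tag s) (tagged s) end)) ->
  (* (A1) *)
  (exists M : R, forall d j r,
      (\int[P d]_w ((Z d j w r) ^+ 4)%:E <= M%:E)%E) ->
  (* (A2): U = Z_j - X_il with Z_j ~ F_j, X_il ~ F_i independent *)
  (forall j i l,
      (fun d : nat =>
         (\sum_(r < d) \sum_(s < d | s != r)
            `| Corr (P d) (fun w => (Z d j w r - X d i l w r) ^+ 2)
                          (fun w => (Z d j w s - X d i l w s) ^+ 2) |)
         / (d%:R ^+ 2)) @ \oo --> (0 : R)) ->
  (* (A3) *)
  (forall j, (fun d : nat =>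
      (\sum_(r < d) Var (P d) (fun w => Z d j w r)) / d%:R) @ \oo --> sigma2 j) ->
  (forall j i, i != j -> (fun d : nat =>
      (\sum_(r < d) (Ex (P d) (fun w => Z d j w r) - Ex (P d) (fun w => Z d i w r)) ^+ 2)
        / d%:R) @ \oo --> nu2 j i) ->
  (* (a) k-NN classifier, 1 <= k < min n_j *)
  ((1 <= k)%N -> (forall j, (k < n j)%N) ->
     ((forall j i, j != i -> `|sigma2 j - sigma2 i| < nu2 j i) ->
        forall j, (fun d => P d [set w | ~ knn_surely (Z d j w) (fun j0 i0 => X d j0 i0 w) k j])
                    @ \oo --> 0%E)
     /\
     ((exists j i, j != i /\ nu2 j i < `|sigma2 j - sigma2 i|) ->
        exists j, (fun d => P d [set w | ~ knn_possibly (Z d j w) (fun j0 i0 => X d j0 i0 w) k j])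
                    @ \oo --> 1%E))
  /\
  (* (b) CH classifier *)
  ((forall j i, j != i -> 0 < nu2 j i) ->
     forall j, (fun d => P d [set w | ~ CH_assign (Z d j w) (fun j0 i0 => X d j0 i0 w) j])
                 @ \oo --> 0%E)
  /\
  (* (c) MCH classifier *)
  ((forall j i, j != i -> 0 < nu2 j i \/ sigma2 j != sigma2 i) ->
     forall j, (fun d => P d [set w | ~ MCH_assign (Z d j w) (fun j0 i0 => X d j0 i0 w) j])
                 @ \oo --> 0%E).
Proof.
move=> _ n2 mX mZ lawX ind [M Z4] corr trace mean.
split; first move=> k1 kn; first split.
- exact: (knn_consistent P X Z sigma2 nu2 M mX mZ lawX ind Z4 corr trace mean k k1 kn).
- exact: (knn_inconsistent P X Z sigma2 nu2 M mX mZ lawX ind Z4 corr trace mean k k1 kn).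
split.
- exact: (CH_consistent P X Z sigma2 nu2 M n2 mX mZ lawX ind Z4 corr trace mean).
- exact: (MCH_consistent P X Z sigma2 nu2 M n2 mX mZ lawX ind Z4 corr trace mean).
Qed.
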